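(* As $d\to\infty$, the critical probability $p_{\mathrm L}(d)$ for Lipschitz percolation in $\mathbb Z^d$ satisfies $$p_{\mathrm L}(d)\ge 1-\frac{1+\mathrm o(1)}{2d},$$ that is, there is a sequence $\varepsilon_d\to0$ such that $p_{\mathrm L}(d)\ge 1-(1+\varepsilon_d)/(2d)$ for all $d\ge 2$.
   Context: Let $\mathbb Z^+=\{1,2,\dots\}$ and let $\|\cdot\|$ be the $\ell^1$-norm. Site percolation on $\mathbb Z^d$ ($d\ge2$) with parameter $p\in[0,1]$: each site is independently open with probability $p$ and closed otherwise; the law is $\mathbb P_p$. A function $F:\mathbb Z^{d-1}\to\mathbb Z^+$ is Lipschitz if $|F(x)-F(y)|\le 1$ for all $x,y\in\mathbb Z^{d-1}$ with $\|x-y\|=1$. Let $\mathrm{LIP}$ be the event that there exists a Lipschitz function $F:\mathbb Z^{d-1}\to\mathbb Z^+$ such that, for each $x\in\mathbb Z^{d-1}$, the site $(x,F(x))\in\mathbb Z^d$ is open. The event $\mathrm{LIP}$ is increasing and has $\mathbb P_p$-probability $0$ or $1$; $p_{\mathrm L}=p_{\mathrm L}(d)\in[0,1]$ is the number such that $\mathbb P_p(\mathrm{LIP})=0$ if $p<p_{\mathrm L}$ and $\mathbb P_p(\mathrm{LIP})=1$ if $p>p_{\mathrm L}$. *)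

(* Defs.v *)
From mathcomp Require Import all_boot all_order all_algebra.
From mathcomp Require Import all_classical all_reals all_analysis.

Set Implicit Arguments.
Unset Strict Implicit.
Unset Printing Implicit Defensive.

Import Order.TTheory GRing.Theory Num.Theory.
Import numFieldNormedType.Exports.

Local Open Scope classical_set_scope.
Local Open Scope ring_scope.

Definition l1norm (n : nat) (x : 'rV[int]_n) : int := \sum_(i < n) `|x ord0 i|.

(* The site (x, h) of Z^d, for x in Z^(d-1): [insub] recovers the index of a
   coordinate of x, and fails exactly at the last coordinate (for d >= 1). *)
Definition site_above (d : nat) (x : 'rV[int]_d.-1) (h : int) : 'rV[int]_d :=
  \row_(i < d) (if insub (val i) is Some j then x ord0 j else h).

(* The values of a Lipschitz function lie in Z^+ = {1, 2, ...}. *)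
Definition Lipschitz (n : nat) (F : 'rV[int]_n -> int) : Prop :=
  (forall x, 1 <= F x) /\
  (forall x y, l1norm (x - y) = 1 -> `|F x - F y| <= 1).

(* A configuration maps a site to [true] when that site is open. *)
Definition site_open (d : nat) (x : 'rV[int]_d) : set ('rV[int]_d -> bool) :=
  [set w | w x].

(* Configurations with the product sigma-algebra, which is generated by the
   events "x is open". *)
Notation configuration d := (g_sigma_algebraType (range (@site_open d))).

Definition mutually_independent (disp : measure_display)
    (T : measurableType disp) (R : realType) (P : probability T R)
    (I : choiceType) (E : I -> set T) : Prop :=
  forall s : seq I, uniq s ->
    P (\bigcap_(i in [set` s]) E i) = (\prod_(i <- s) P (E i))%E.

(* These conditions determine P on the product sigma-algebra. *)
Definition site_percolation_law (R : realType) (d : nat) (p : R)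
    (P : probability (configuration d) R) : Prop :=
  (forall x, P (site_open x) = p%:E) /\ mutually_independent P (@site_open d).

Definition LIP (d : nat) : set (configuration d) :=
  [set w | exists F : 'rV[int]_d.-1 -> int,
     Lipschitz F /\ forall x, site_open (site_above x (F x)) w].

Definition is_critical_probability (R : realType) (d : nat)
    (P : R -> probability (configuration d) R) (pL : R) : Prop :=
  0 <= pL <= 1 /\
  forall p, 0 <= p <= 1 ->
    (p < pL -> P p (@LIP d) = 0%E) /\ (pL < p -> P p (@LIP d) = 1%E).

(* Main.v *)
Require Import Defs.
From mathcomp Require Import all_boot all_order all_algebra.
From mathcomp Require Import all_classical all_reals all_analysis.
From mathcomp Require Import lra ring zify.

Set Implicit Arguments.
Unset Strict Implicit.
Unset Printing Implicit Defensive.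

Import Order.TTheory GRing.Theory Num.Theory.
Import numFieldNormedType.Exports.
Local Open Scope classical_set_scope.
Local Open Scope ring_scope.

(** Write q for the probability that a site is closed. A Lipschitz function F
    through open sites satisfies F >= 1, and if F x >= h with (x, h) closed then
    F x >= h + 1, hence F y >= h at each neighbour y of x. The heights forced by
    these rules ([forced]) are exactly the obstruction to LIP: LIP fails if and only
    if all heights are forced at some point ([LIP_forced]). It is therefore enough
    that, when q = (1 + e) / (2 d) and d is large, each height is forced at the
    origin with probability at least 1/2 ([forced_ge_half]): then LIP has
    probability at most 1/2 ([LIP_le_half]), so that 1 - q cannot exceed the
    critical probability.

    To see that height K is forced at 0, apply the rules backwards. If it suffices
    to force height h at x, it suffices to force height h + 1 at any neighbour of x,
    or height h at any neighbour y with (y, h) closed, or height h - 1 at x if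
    (x, h - 1) is closed; one wins on reaching height 1. So at a fixed height one
    can follow the cluster of closed sites around x, in which a vertex has about
    2 d q > 1 closed neighbours. Two vertices have at most four common neighbours,
    so until S = d / s vertices have been processed (s a large constant) a new
    vertex still has nearly 2 d unexplored neighbours, and the exploration is
    supercritical: it reaches S vertices with probability bounded below
    ([likely_cluster]). Right below one of S vertices there is a closed site with
    probability about 1 - exp (- q S), also bounded below. Hence one level is gained with a
    probability b that does not depend on d ([likely_descent1]), and three
    levels with probability b ^ 3 ([likely_descent]).

    Moving by one step in one of nu fixed directions, at the cost of one level,
    gives nu starting points whose explorations live in disjoint affine subspaces,
    and are thus independent; for nu constant and large, one of them gains three
    levels with probability at least 3/4 ([likely_attempts]). A last step, in a
    direction kept for this purpose and at the cost of one level, leads to a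
    hyperplane without explored sites. Altogether the height decreases by 1 with
    probability at least 3/4 and increases by 1 otherwise, so this walk reaches
    height 1 with probability 1 ([likely_walk]).

    The exploration is adaptive. Instead of stopping times, each of these lemmas
    bounds from below the probability of the target event conditionally on the
    answers recorded so far ([likely]), and takes as hypotheses such bounds for the
    records in which the exploration may end. *)

(** * Adaptive exploration of independent events *)

Section Exploration.
Context {disp : measure_display} {T : measurableType disp} {R : realType}.
Variables (P : probability T R) (I : choiceType) (opn : T -> I -> bool) (p : R).
Hypothesis m_opn : forall i, measurable [set w | opn w i].
Hypothesis P_opn : forall i, P [set w | opn w i] = p%:E.
Hypothesis indep : mutually_independent P (fun i => [set w | opn w i]).

(** The record of an exploration lists the queried sites with the answers: [true] for
    an open site. *)
Definition agrees (c : seq (I * bool)) (w : T) := all (fun t => opn w t.1 == t.2) c.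
Notation cyl c := [set w | agrees c w].
Notation keys c := (map fst c).

Let pr (A : set T) : R := fine (P A).

Lemma measurable_answer i b : measurable [set w | opn w i == b].
Proof.
case: b.
  by rewrite (_ : mkset _ = [set w | opn w i]) //; apply/seteqP; split=> w /= /eqP.
rewrite (_ : mkset _ = ~` [set w | opn w i]); first exact: measurableC.
by apply/seteqP; split=> w /= => [/eqP ->|/negP/negbTE ->].
Qed.

Lemma cyl_cons t c : cyl (t :: c) = [set w | opn w t.1 == t.2] `&` cyl c.
Proof. by apply/seteqP; split=> w /=; rewrite /agrees /= => /andP. Qed.

Lemma measurable_cyl c : measurable (cyl c).
Proof.
elim: c => [|t c IH]; first by rewrite (_ : mkset _ = setT) //; apply/seteqP; split.
by rewrite cyl_cons; apply: measurableI => //; exact: measurable_answer.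
Qed.

Lemma pr_split (A : set T) i : measurable A ->
  pr A = pr ([set w | opn w i == true] `&` A) + pr ([set w | opn w i == false] `&` A).
Proof.
move=> mA; rewrite /pr.
have mb b : measurable ([set w | opn w i == b] `&` A).
  by apply: measurableI => //; exact: measurable_answer.
rewrite -fineD ?fin_num_measure //; congr fine.
rewrite -measureU //.
  congr (P _); apply/seteqP; split=> w /=; last by case=> -[].
  by case: (opn w i) => Aw; [left|right].
by apply/seteqP; split=> w //= -[[/eqP -> _] [/eqP]].
Qed.

Lemma pr_open_seq s : uniq s -> pr (cyl [seq (i, true) | i <- s]) = p ^+ size s.
Proof.
move=> us; rewrite /pr.
have -> : cyl [seq (i, true) | i <- s] = \bigcap_(i in [set` s]) [set w | opn w i].
  apply/seteqP; split=> w /=; rewrite /agrees all_map.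
    by move=> /allP /= H i /H /eqP.
  by move=> H; apply/allP => i /H /= ->.
rewrite indep // (eq_bigr (fun=> p%:E)) //.
by elim: s {us} => [|i s IH]; rewrite ?big_nil //= big_cons exprS /= fineM ?IH // prodEFin.
Qed.

(** Independence is assumed for open events only. Each closed event in [c] is removed
    by writing it as a difference, which adds one index to the list [s] of open ones. *)
Lemma pr_open_cyl (c : seq (I * bool)) s : uniq (s ++ keys c) ->
  pr (cyl ([seq (i, true) | i <- s] ++ c)) = p ^+ size s * pr (cyl c).
Proof.
elim: c s => [|[i b] c IH] s.
  rewrite !cats0 => us; rewrite pr_open_seq // (_ : pr (cyl [::]) = 1) ?mulr1 //.
  by have := @pr_open_seq [::] isT; rewrite expr0.
move=> us.
have swap b' : cyl ([seq (i, true) | i <- s] ++ (i, b') :: c) =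
    [set w | opn w i == b'] `&` cyl ([seq (i, true) | i <- s] ++ c).
  rewrite -(cyl_cons (i, b')); apply/seteqP; split=> w /=; rewrite /agrees /= !all_cat /=;
  by case: (opn w i == b'); rewrite ?andbF.
have us' : uniq (s ++ keys c).
  by move: us; rewrite /= !cat_uniq /= => /and3P[-> /norP[_ ->] /andP[_ ->]].
have us'' : uniq ((i :: s) ++ keys c) by move: us; rewrite /= -cat1s uniq_catCA.
have ui : uniq ([:: i] ++ keys c) by move: us; rewrite /= cat_uniq => /and3P[].
have openE : pr (cyl ([seq (i, true) | i <- s] ++ (i, true) :: c)) =
    p ^+ (size s).+1 * pr (cyl c).
  by rewrite -(IH (i :: s)) // swap -(cyl_cons (i, true)).
have openE0 : pr (cyl ((i, true) :: c)) = p * pr (cyl c) by rewrite -(IH [:: i]).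
case: b us => us; first by rewrite openE openE0 exprS; ring.
have := @pr_split _ i (measurable_cyl ([seq (i, true) | i <- s] ++ c)).
rewrite -!swap openE IH // => E1.
have := @pr_split _ i (measurable_cyl c).
rewrite -!(cyl_cons (i, _)) openE0 => E2.
move: E1; rewrite {1}E2 exprS; set a := pr _; set b := pr _; set e := pr _; lra.
Qed.

Section Target.
Variable E : set T.
Hypothesis mE : measurable E.

(** The probability of [E] conditionally on the record [c] is at least [v]. The product
    form avoids a division by the probability of the record, and only records that
    query no site twice matter. *)
Definition likely (c : seq (I * bool)) (v : R) :=
  uniq (keys c) -> v * pr (cyl c) <= pr (cyl c `&` E).

Lemma pr_ge0 A : 0 <= pr A. Proof. by rewrite fine_ge0. Qed.

Lemma pr_cyl1 i b c : uniq (i :: keys c) ->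
  pr (cyl ((i, b) :: c)) = (if b then p else 1 - p) * pr (cyl c).
Proof.
move=> u; have o : pr (cyl ((i, true) :: c)) = p * pr (cyl c).
  by rewrite -(@pr_open_cyl c [:: i]).
case: b => //; have := pr_split i (measurable_cyl c).
rewrite -!(cyl_cons (i, _)) o mulrBl mul1r => E1.
by apply/eqP; rewrite eq_sym subr_eq addrC; apply/eqP.
Qed.

Lemma likely_sure c : (forall w, agrees c w -> E w) -> likely c 1.
Proof.
move=> cE _; rewrite mul1r (_ : _ `&` E = cyl c) //.
by apply/seteqP; split=> w [] //= cw; split=> //; exact: cE.
Qed.

Lemma likely_le0 c v : v <= 0 -> likely c v.
Proof. by move=> v0 _; apply: le_trans (pr_ge0 _); rewrite mulr_le0_ge0 ?pr_ge0. Qed.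

Lemma likely_le c v v' : v' <= v -> likely c v -> likely c v'.
Proof. by move=> le_v L /L; apply: le_trans; rewrite ler_wpM2r ?pr_ge0. Qed.

Lemma likely_query c i v0 v1 : i \notin keys c ->
  likely ((i, true) :: c) v0 -> likely ((i, false) :: c) v1 ->
  likely c (p * v0 + (1 - p) * v1).
Proof.
move=> ic L0 L1 uc; have u : uniq (i :: keys c) by rewrite /= ic.
have mcE : measurable (cyl c `&` E) by apply: measurableI => //; exact: measurable_cyl.
rewrite (pr_split i mcE).
have := lerD (L0 u) (L1 u).
rewrite !pr_cyl1 //= !(cyl_cons (i, _)) !setIA; apply: le_trans.
by rewrite le_eqVlt; apply/orP; left; apply/eqP; ring.
Qed.

(** The record [c'] refines [c], and its new queries lie in [Q]. *)
Definition extends (Q : I -> Prop) (c c' : seq (I * bool)) :=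
  (forall w, agrees c' w -> agrees c w) /\
  (forall i, i \in keys c' -> i \in keys c \/ Q i).

Lemma extends_refl Q c : extends Q c c.
Proof. by split=> // i; left. Qed.

Lemma extends_trans Q c1 c2 c3 : extends Q c1 c2 -> extends Q c2 c3 -> extends Q c1 c3.
Proof. by move=> [a12 k12] [a23 k23]; split=> [w /a23/a12|i /k23 [/k12|]] //; right. Qed.

Lemma extends_sub (Q Q' : I -> Prop) c c' :
  (forall i, Q i -> Q' i) -> extends Q c c' -> extends Q' c c'.
Proof. by move=> QQ' [a k]; split=> // i /k [|/QQ']; [left|right]. Qed.

(** The bound is the value of an interpolation between [V0] and [V1] in which each closed
    site multiplies the distance to [V1] by [rho]; each query multiplies the mean of this
    distance by 1 - (1 - p) (1 - rho). With [rho] the extinction bound of a branching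
    process, this is the supermartingale of a growing cluster; with [rho] = 0, it
    says that some queried site is closed, since 0 ^ 0 = 1. *)
Lemma likely_query_seq (V0 V1 rho A : R) ns c :
  uniq ns -> (forall i, i \in ns -> i \notin keys c) ->
  (forall c' cl, extends (fun j => j \in ns) c c' -> subseq cl ns ->
     (forall w i, agrees c' w -> i \in cl -> ~~ opn w i) ->
     likely c' (V0 + (V1 - V0) * (1 - A * rho ^+ size cl))) ->
  likely c (V0 + (V1 - V0) * (1 - A * (1 - (1 - p) * (1 - rho)) ^+ size ns)).
Proof.
elim: ns A c => [|i ns IH] A c.
  by move=> _ _ /(_ c [::]); rewrite expr0; apply => //; exact: extends_refl.
rewrite cons_uniq => /andP[ins uns] fresh H; set r := 1 - _ * (1 - rho).
have ic : i \notin keys c by apply: fresh; rewrite inE eqxx.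
have fresh' b j : j \in ns -> j \notin keys ((i, b) :: c).
  move=> jns; rewrite /= inE negb_or fresh ?inE ?jns ?orbT // andbT.
  by apply: contraNneq ins => <-.
have ext b c' : extends (fun j => j \in ns) ((i, b) :: c) c' ->
    extends (fun j => j \in i :: ns) c c'.
  move=> [a k]; split=> [w /a /andP[]//|j /k]; rewrite /= !inE.
  by move=> [/orP[->|]|->]; [right|left|right; rewrite orbT].
apply: (@likely_le _ (p * (V0 + (V1 - V0) * (1 - A * r ^+ size ns)) +
    (1 - p) * (V0 + (V1 - V0) * (1 - A * rho * r ^+ size ns)))).
  by rewrite le_eqVlt exprS; apply/orP; left; apply/eqP; rewrite {1}/r; ring.
apply: (likely_query ic).
- apply: (IH A) => // [j|c' cl /[dup] e /ext e' scl Hcl]; first exact: fresh'.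
  by apply: H => //; apply: subseq_trans scl _; exact: subseq_cons.
- apply: (IH (A * rho)) => // [j|c' cl /[dup] e /ext e' scl Hcl]; first exact: fresh'.
  rewrite -mulrA -exprS; apply: (H c' (i :: cl)) => //; first by rewrite /= eqxx.
  move=> w j c'w; rewrite inE => /orP[/eqP->|]; last exact: Hcl.
  by have /andP[/= /eqP-> _] := e.1 _ c'w.
Qed.

End Target.
End Exploration.

(** * Neighbours in the integer lattice *)

Section Lattice.
Variable n : nat.
Notation X := 'rV[int]_n.

Definition dir (i : 'I_n) : X := delta_mx ord0 i.

Lemma dirE i k : dir i ord0 k = (k == i)%:R.
Proof. by rewrite mxE eqxx. Qed.

Lemma dir_inj : injective dir.
Proof. by move=> i j /rowP /(_ i); rewrite !dirE eqxx; case: eqP. Qed.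

Lemma l1norm_dir i : l1norm (dir i) = 1.
Proof.
rewrite /l1norm (bigD1 i) //= dirE eqxx big1 ?addr0 // => k ki.
by rewrite dirE (negbTE ki).
Qed.

Lemma l1normN (x : X) : l1norm (- x) = l1norm x.
Proof. by apply: eq_bigr => i _; rewrite mxE normrN. Qed.

Lemma l1norm_subC (x y : X) : l1norm (x - y) = l1norm (y - x).
Proof. by rewrite -l1normN opprB. Qed.

(** Only steps along the directions in [J]. *)
Definition neighbours (J : seq 'I_n) (v : X) : seq X :=
  [seq v + dir i | i <- J] ++ [seq v - dir i | i <- J].

Lemma neighboursP J v u : reflect
  (exists2 i, i \in J & u = v + dir i \/ u = v - dir i) (u \in neighbours J v).
Proof.
rewrite mem_cat; apply: (iffP orP) => [[] /mapP[i iJ ->]|[i iJ [->|->]]].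
- by exists i; [|left].
- by exists i; [|right].
- by left; apply: map_f.
- by right; apply: (map_f (fun i => v - dir i)).
Qed.

Lemma size_neighbours J v : size (neighbours J v) = (2 * size J)%N.
Proof. by rewrite size_cat !size_map addnn mul2n. Qed.

Lemma uniq_neighbours J v : uniq J -> uniq (neighbours J v).
Proof.
move=> uJ; rewrite cat_uniq !map_inj_uniq ?uJ ?andbT //=; last 2 first.
- by move=> i j /addrI /oppr_inj /dir_inj.
- by move=> i j /addrI /dir_inj.
apply/hasPn => u /mapP[i _ ->]; apply/mapP => -[j _ /addrI /rowP /(_ i)].
by rewrite mxE !dirE eqxx; case: eqP.
Qed.

Lemma l1norm_neighbour J v u : u \in neighbours J v -> l1norm (v - u) = 1.
Proof.
move=> /neighboursP[i _ [->|->]]; first by rewrite l1norm_subC addrC addKr l1norm_dir.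
by rewrite opprB addrC subrK l1norm_dir.
Qed.

Lemma neighbour_off J v u k : u \in neighbours J v -> k \notin J -> u ord0 k = v ord0 k.
Proof.
move=> /neighboursP[i iJ e] kJ; have ki : k != i by apply: contraNneq kJ => ->.
by case: e => ->; rewrite !mxE eqxx (negbTE ki) ?subr0 ?addr0.
Qed.

(** If [u] and [v] differ at the coordinate [k], a common neighbour has to be obtained
    from one of them by a step along [k]: otherwise it would agree with both at [k]. *)
Lemma common_neighbours J u v : uniq J -> u != v ->
  (count [in neighbours J u] (neighbours J v) <= 4)%N.
Proof.
move=> uJ uv; have [k uvk] : exists k, u ord0 k != v ord0 k.
  apply/existsP; rewrite -negb_forall; apply: contraNN uv => /forallP uv.
  by apply/eqP/rowP => k; exact/eqP/uv.
rewrite -size_filter.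
apply: (@uniq_leq_size _ _ [:: v + dir k; v - dir k; u + dir k; u - dir k]).
  by rewrite filter_uniq // uniq_neighbours.
move=> w; rewrite mem_filter !inE => /andP[/neighboursP[j _ wu] /neighboursP[i _ wv]].
have [ik|ik] := eqVneq i k.
  by rewrite -ik; case: wv => ->; rewrite eqxx ?orbT.
have [jk|jk] := eqVneq j k.
  by rewrite -jk; case: wu => ->; rewrite eqxx ?orbT.
case/eqP: uvk; transitivity (w ord0 k).
  by case: wu => ->; rewrite !mxE eqxx eq_sym (negbTE jk) ?subr0 ?addr0.
by case: wv => ->; rewrite !mxE eqxx eq_sym (negbTE ik) ?subr0 ?addr0.
Qed.

(** The vertices that may have been queried once [D] has been processed, when those
    in [Q] were queried before the exploration began. *)
Definition seen J (Q D : seq X) : seq X := Q ++ flatten (map (neighbours J) D).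

Lemma size_unseen J Q D v : uniq J -> v \notin D ->
  (2 * size J - (size Q + 4 * size D) <=
   size [seq u <- neighbours J v | u \notin seen J Q D])%N.
Proof.
move=> uJ vD; have uN := uniq_neighbours v uJ.
rewrite -(size_neighbours J v) -(count_predC [in seen J Q D] (neighbours J v)) size_filter.
rewrite leq_subLR; apply: leq_add => //.
elim: D vD => [_|u D IH].
  rewrite /seen cats0 muln0 addn0 -size_filter uniq_leq_size ?filter_uniq //.
  by move=> w; rewrite mem_filter => /andP[].
rewrite inE negb_or => /andP[vu /IH{}IH].
apply: leq_trans (_ : (count [in seen J Q D] (neighbours J v) +
   count [in neighbours J u] (neighbours J v) <= _)%N); last first.
  by rewrite /= mulnS addnCA addnC leq_add // common_neighbours // eq_sym.
rewrite -count_predUI; apply: leq_trans (leq_addr _ _).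
by apply: sub_count => w; rewrite !inE /seen /= !mem_cat => /or3P[] ->; rewrite ?orbT.
Qed.

End Lattice.

(** * Heights forced by the closed sites *)

Section Forced.
Variable d : nat.
Notation X := 'rV[int]_d.-1.
Implicit Types (w : configuration d) (x y : X).

Definition is_open w (s : X * int) : bool := w (site_above s.1 s.2).

(** The index [k] bounds the length of the derivation, which makes measurability an
    induction. *)
Fixpoint forced_in (k : nat) w x (h : int) : Prop :=
  if k is k'.+1 then
    [\/ forced_in k' w x h,
        forced_in k' w x (h - 1) /\ ~~ is_open w (x, h - 1) |
        exists y, l1norm (x - y) = 1 /\ forced_in k' w y (h + 1)]
  else h <= 1.

Definition forced w x h := exists k, forced_in k w x h.

Lemma forced_base w x h : h <= 1 -> forced w x h.
Proof. by exists 0%N. Qed.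

Lemma forced_up w x h : forced w x (h - 1) -> ~~ is_open w (x, h - 1) -> forced w x h.
Proof. by move=> [k f] o; exists k.+1; apply: Or32. Qed.

Lemma forced_side w x y h : l1norm (x - y) = 1 -> forced w y (h + 1) -> forced w x h.
Proof. by move=> xy [k f]; exists k.+1; apply: Or33; exists y. Qed.

Lemma forced_pred w x h : forced w x (h + 1) -> forced w x h.
Proof.
move=> [k]; elim: k x h => [|k IH] x h /=.
  by move=> h0; apply: forced_base; lia.
case=> [/IH//|[]|[y [xy /IH f]]]; last exact: forced_side xy f.
by rewrite addrK; exists k.
Qed.

Lemma forced_le w x (h h' : int) : h' <= h -> forced w x h -> forced w x h'.
Proof.
move=> le; have -> : h = h' + Posz (absz (h - h')) by lia.
elim: (absz (h - h')) => [|k IH]; first by rewrite addr0.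
by rewrite -addn1 PoszD addrA => /forced_pred.
Qed.

Lemma forced_lower_bound w F x h :
  Lipschitz F -> (forall x, is_open w (x, F x)) -> forced w x h -> h <= F x.
Proof.
move=> [F1 FL] Fo [k]; elim: k x h => [|k IH] x h /=.
  by move=> /le_trans; apply.
case=> [/IH//|[/IH]|[y [xy /IH]]].
  rewrite le_eqVlt => /orP[/eqP ->|]; first by rewrite Fo.
  by lia.
by have := FL _ _ xy; lia.
Qed.

(** If the heights forced at each point are bounded, the largest ones define the lowest
    open Lipschitz function: it is open because a closed site would force one more level,
    and Lipschitz by the rule for neighbours. *)
Lemma LIP_forced : @LIP d = \bigcap_x \bigcup_(k : nat) ~` [set w | forced w x k%:Z].
Proof.
apply/seteqP; split => w /=.
  move=> [F [FL Fo]] x _; exists (absz (F x + 1)) => //= f.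
  by have := forced_lower_bound FL Fo f; have := FL.1 x; lia.
move=> H.
have ex x : exists h : int, forced w x h /\ ~ forced w x (h + 1).
  have [k _ /= nk] := H x I.
  elim: k nk => [|k IH] nk; first by case: nk; apply: forced_base.
  have [f|/IH//] := pselect (forced w x k).
  by exists k; split; rewrite // -PoszD addn1.
exists (fun x => xget 0 [set h : int | forced w x h /\ ~ forced w x (h + 1)]).
set F := fun x => _.
have FP x : forced w x (F x) /\ ~ forced w x (F x + 1).
  by rewrite /F; case: xgetP => [h _ //|N]; have [h /N] := ex x.
have Fmax x h : forced w x h -> h <= F x.
  by rewrite leNgt => f; apply/negP => lt; apply: (FP x).2; apply: forced_le f; lia.
split; [split|].
- by move=> x; apply: Fmax; apply: forced_base.
- move=> x y xy; have yx : l1norm (y - x) = 1 by rewrite l1norm_subC.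
  have a : forced w x (F y - 1) by apply: forced_side xy _; rewrite subrK; exact: (FP y).1.
  have b : forced w y (F x - 1) by apply: forced_side yx _; rewrite subrK; exact: (FP x).1.
  by have := Fmax _ _ a; have := Fmax _ _ b; lia.
- move=> x; apply/negPn/negP => /negP o; apply: (FP x).2.
  by apply: forced_up; rewrite addrK; [exact: (FP x).1|apply/negP].
Qed.

Lemma measurable_is_open s : measurable [set w : configuration d | is_open w s].
Proof. by apply: sub_sigma_algebra; exists (site_above s.1 s.2). Qed.

Lemma measurable_forced x h : measurable [set w | forced w x h].
Proof.
rewrite (_ : mkset _ = \bigcup_k [set w | forced_in k w x h]); last first.
  by apply/seteqP; split=> w /= [k]; [exists k|exists k].
apply: bigcupT_measurable => k; elim: k x h => [|k IH] x h /=.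
  have [h1|h1] := boolP (h <= 1).
    by rewrite (_ : mkset _ = setT) //; apply/seteqP; split.
  by rewrite (_ : mkset _ = set0) //; apply/seteqP; split.
rewrite (_ : mkset _ = [set w | forced_in k w x h] `|`
  ([set w | forced_in k w x (h - 1)] `\` [set w | is_open w (x, h - 1)]) `|`
  \bigcup_y ([set w | l1norm (x - y) = 1 /\ forced_in k w y (h + 1)])); last first.
  apply/seteqP; split=> w /=.
    by case=> [f|[f /negP o]|[y f]]; [left; left|left; right|right; exists y].
  by case=> [[f|[f /negP o]]|[y _ f]]; [apply: Or31|apply: Or32|apply: Or33; exists y].
apply: measurableU; first apply: measurableU; first exact: IH.
  by apply: measurableD; [exact: IH|exact: measurable_is_open].
apply: countable_bigcupT_measurable => [|y]; first exact: countableP.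
have [xy|xy] := eqVneq (l1norm (x - y)) 1.
  rewrite (_ : mkset _ = [set w | forced_in k w y (h + 1)]) //.
  by apply/seteqP; split=> w //= -[].
by rewrite (_ : mkset _ = set0) //; apply/seteqP; split=> w //= -[/eqP]; rewrite (negbTE xy).
Qed.

End Forced.

(** * Backward exploration *)

Lemma int_pred_neq (h : int) : h - 1 <> h. Proof. lia. Qed.
Lemma int_pred_le (h : int) : h - 1 <= h. Proof. lia. Qed.
Lemma int_nle_pred (h : int) : (h <= h - 1) = false. Proof. lia. Qed.
Lemma int_succ_neq (h : int) : h + 1 <> h. Proof. lia. Qed.
Lemma int_subS (h : int) (m : nat) : h - m.+1%:Z = h - 1 - m%:Z. Proof. lia. Qed.
Lemma int_walk (k : nat) : k%:Z = k.+1%:Z + 1 + 1 - 3%:Z. Proof. lia. Qed.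

Section Percolation.
Variable d : nat.
Hypothesis d_gt1 : (1 < d)%N.
Notation X := 'rV[int]_d.-1.

(** Sites are explored as pairs of a position and a height. *)
Lemma site_above_inj : injective (fun s : X * int => site_above s.1 s.2).
Proof.
move=> [x h] [y k] /= /rowP e; congr pair.
  apply/rowP => j; have lt : (j < d)%N by apply: leq_trans (ltn_ord j) (leq_pred d).
  have := e (Ordinal lt); rewrite !mxE /= insubT //= => lt'.
  by rewrite (_ : Sub _ _ = j) //; apply: val_inj.
have lt : (d.-1 < d)%N by rewrite prednK // ltnW.
by have := e (Ordinal lt); rewrite !mxE /= insubF ?ltnn.
Qed.

Context {R : realType}.
Variables (p : R) (P : probability (configuration d) R).
Hypothesis law : site_percolation_law p P.
Hypothesis p01 : 0 <= p <= 1.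

Lemma P_is_open s : P [set w | is_open w s] = p%:E.
Proof. exact: law.1. Qed.

Lemma is_open_independent : mutually_independent P (fun s => [set w | is_open w s]).
Proof.
move=> s us; have := law.2 _ (etrans (map_inj_uniq site_above_inj s) us).
rewrite big_map => <-; congr (P _); apply/seteqP; split=> w /= H.
  by move=> _ /mapP[t ts ->]; exact: H.
by move=> t /= ts; apply: (H (site_above t.1 t.2)) => /=; apply/mapP; exists t.
Qed.

Variable E : set (configuration d).
Hypothesis mE : measurable E.
Notation L := (likely P (@is_open d) E).
Notation ext := (extends (@is_open d)).
Notation known := (agrees (@is_open d)).
Notation keys c := (map fst c).
Notation record := (seq (X * int * bool)).

(** The backward exploration has led from the target event to height [h] at [x]. *)
Definition reached (c : record) (x : X) (h : int) :=
  forall w, known c w -> forced w x h -> E w.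

Lemma reached_ext Q c c' x h : ext Q c c' -> reached c x h -> reached c' x h.
Proof. by move=> [a _] s w /a; exact: s. Qed.

Lemma reached_side c x y h : l1norm (x - y) = 1 -> reached c x h -> reached c y (h + 1).
Proof. by move=> xy s w cw f; apply: s cw _; exact: forced_side xy f. Qed.

Lemma reached_down c x h : reached c x h ->
  (forall w, known c w -> ~~ is_open w (x, h - 1)) -> reached c x (h - 1).
Proof. by move=> s o w cw f; apply: s (cw) _; apply: forced_up f _; exact: o. Qed.

(** A free step up to a neighbour, followed by a step down to the closed site. *)
Lemma reached_across c x y h : l1norm (x - y) = 1 -> reached c x h ->
  (forall w, known c w -> ~~ is_open w (y, h)) -> reached c y h.
Proof.
move=> xy s o; rewrite -(addrK 1 h); apply: reached_down; first exact: reached_side s.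
by rewrite addrK.
Qed.

(** Clusters grow along the directions in [J] until [S] vertices have been processed.
    The hypothesis [rhoP] says that [rho] bounds the extinction probability of a
    branching process in which each vertex has 2 |J| - 5 S potential children, each
    of which is present with probability 1 - p. *)
Variables (J : seq 'I_d.-1) (S : nat) (rho : R).
Hypothesis uJ : uniq J.
Hypothesis rho01 : 0 <= rho <= 1.
Hypothesis rhoP : (1 - (1 - p) * (1 - rho)) ^+ (2 * size J - 5 * S) <= rho.

(** The affine subspace through [y] in which a cluster grows. *)
Definition fibre (y z : X) : Prop := forall k, k \notin J -> z ord0 k = y ord0 k.

Lemma fibre_neighbour y u v : fibre y u -> v \in neighbours J u -> fibre y v.
Proof. by move=> yu vu k kJ; rewrite (neighbour_off vu kJ) yu. Qed.

Section Attempt.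
Variable y : X.

Section Layer.
Variables (c0 : record) (h : int) (Q : seq X) (V0 V1 : R).
Hypothesis V01 : V0 <= V1.
Hypothesis size_Q : (size Q <= S)%N.
Notation layer := (fun s : X * int => fibre y s.1 /\ s.2 = h).
Hypothesis fail : forall c, ext layer c0 c -> L c V0.
Hypothesis success : forall c D, ext layer c0 c -> uniq D -> size D = S ->
  (forall u, u \in D -> fibre y u /\ reached c u h) -> L c V1.

(** Here [D] lists the processed vertices of the cluster and [A] those that wait. Processing
    a vertex [u] queries its unseen neighbours. At most |Q| + 4 |D| <= 5 S of them have been
    seen, so by [rhoP] the new value is at least the old one, as the loss of the factor
    [rho] of [u] itself is compensated. *)
Lemma likely_cluster k c D A : ext layer c0 c -> (k + size D = S)%N ->
  uniq (D ++ A) ->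
  (forall u, u \in D ++ A -> [/\ fibre y u, reached c u h & u \in seen J Q D]) ->
  (forall s, s \in keys c -> layer s -> s.1 \in seen J Q D) ->
  L c (V0 + (V1 - V0) * (1 - rho ^+ size A)).
Proof.
have /andP[rho0 rho1] := rho01; have /andP[p0 p1] := p01.
elim: k c D A => [|k IH] c D A c0c szD uDA DA cD.
  apply: (@likely_le _ _ _ _ _ _ _ _ V1).
    by rewrite -{2}(subrKC V0 V1) lerD2l ler_piMr ?subr_ge0 // gerBl exprn_ge0.
  apply: (success c0c (D := D)) => //; first by move: uDA; rewrite cat_uniq => /andP[].
  by move=> u uD; have [] := DA u; rewrite ?mem_cat ?uD.
case: A uDA DA => [|u A] uDA DA.
  by rewrite expr0 subrr mulr0 addr0; exact: fail.
have [yu su uQ] : [/\ fibre y u, reached c u h & u \in seen J Q D].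
  by apply: DA; rewrite mem_cat inE eqxx orbT.
have uD : u \notin D by move: uDA; rewrite cat_uniq /= negb_or => /and3P[_ /andP[]].
pose ns := [seq v <- neighbours J u | v \notin seen J Q D].
have ns_u v : v \in ns -> v \in neighbours J u by rewrite mem_filter => /andP[].
have ns_D v : v \in ns -> v \notin seen J Q D by rewrite mem_filter => /andP[].
pose r := 1 - (1 - p) * (1 - rho).
have r0 : 0 <= r by rewrite subr_ge0 mulr_ile1 ?subr_ge0 // gerBl.
have r1 : r <= 1 by rewrite gerBl mulr_ge0 // subr_ge0.
have r_ns : r ^+ size ns <= rho.
  apply: le_trans rhoP; apply: ler_wiXn2l => //.
  apply: leq_trans (size_unseen Q uJ uD); apply: leq_sub2l.
  by rewrite (mulnDl 1 4) mul1n leq_add // leq_mul2l -szD leq_addl.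
apply: (@likely_le _ _ _ _ _ _ _ _ (V0 + (V1 - V0) * (1 - rho ^+ size A * r ^+ size ns))).
  by rewrite lerD2l ler_wpM2l ?subr_ge0 // lerD2l lerN2 exprSr ler_wpM2l // exprn_ge0.
rewrite -(size_map (fun v => (v, h)) ns).
have pair_inj : injective (fun v : X => (v, h)) by move=> a b [].
apply: likely_query_seq => //.
- exact: measurable_is_open.
- exact: P_is_open.
- exact: is_open_independent.
- by rewrite map_inj_uniq // filter_uniq // uniq_neighbours.
- move=> _ /mapP[v vns ->]; apply: contraNN (ns_D _ vns) => vc.
  by apply: (cD _ vc); split=> //=; exact: fibre_neighbour yu (ns_u _ vns).
move=> c' cl cc' cl_ns cl_closed.
pose B := map fst cl.
have clE : cl = map (fun v => (v, h)) B.
  rewrite -map_comp -[LHS]map_id; apply/eq_in_map => s /(mem_subseq cl_ns) /mapP[v _ ->] //.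
have subB : subseq B ns.
  have := map_subseq fst cl_ns.
  by rewrite -map_comp (eq_map (g := id)) ?map_id.
have uB : uniq B by apply: subseq_uniq subB _; rewrite filter_uniq // uniq_neighbours.
have cc'_layer : ext layer c c'.
  apply: extends_sub cc' => _ /mapP[v vns ->]; split=> //=.
  exact: fibre_neighbour yu (ns_u _ vns).
have seenS v : v \in seen J Q (u :: D) = (v \in seen J Q D) || (v \in neighbours J u).
  by rewrite /seen /= !mem_cat orbA orbAC.
have -> : size cl = size B by rewrite clE size_map.
rewrite -exprD -size_cat.
apply: (IH c' (u :: D) (A ++ B)).
- exact: extends_trans c0c cc'_layer.
- by rewrite /= addnS -addSn.
- have : uniq ((D ++ u :: A) ++ B).
    rewrite cat_uniq uDA uB andbT /=; apply/hasPn => v vB; apply/negP => vDA.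
    by have [_ _] := DA _ vDA; apply/negP/ns_D/(mem_subseq subB).
  by rewrite -catA => U; rewrite -[u :: D]cat1s -catA uniq_catCA.
- move=> v vDAB; have : v \in D ++ u :: A \/ v \in B.
    move: vDAB; rewrite !(mem_cat, inE).
    by do 4!case: (_ \in _) || case: (_ == _); rewrite ?orbT ?orbF /=; auto.
  case=> [/DA[yv sv vD]|vB].
    by split=> //; [exact: reached_ext cc' sv|rewrite seenS vD].
  have vns := mem_subseq subB vB.
  split; first exact: fibre_neighbour yu (ns_u _ vns).
    apply: reached_across (reached_ext cc' su) _; first exact: l1norm_neighbour (ns_u _ vns).
    by move=> w c'w; apply: cl_closed c'w _; rewrite clE map_f.
  by rewrite seenS (ns_u _ vns) orbT.
- move=> s /cc'.2 [sc ls|/mapP[v vns ->] _]; first by rewrite seenS (cD s sc ls).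
  by rewrite seenS (ns_u _ vns) orbT.
Qed.

End Layer.
Notation inside := (fun s : X * int => fibre y s.1).

(** An exploration can start from [v]: among the sites of the subspace at height [h] or
    below, only some in [Q], at height [h], have been queried. *)
Definition seeded c h v Q := [/\ v \in Q, (size Q <= S)%N, fibre y v, reached c v h &
  forall s, s \in keys c -> inside s -> s.2 <= h -> s.2 = h /\ s.1 \in Q].

Definition descent_prob := (1 - rho) * (1 - p ^+ S).

Lemma descent_prob_ge0 : 0 <= descent_prob.
Proof.
have /andP[rho0 rho1] := rho01; have /andP[p0 p1] := p01.
by rewrite mulr_ge0 ?subr_ge0 // exprn_ile1.
Qed.

(** After a successful growth, the sites just below the [S] vertices of the cluster [D] are
    all queried. They are the only known sites of the subspace at the new height, so [D]
    plays the role of [Q] there. *)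
Lemma likely_descent1 c0 h v Q V0 V1 : V0 <= V1 -> seeded c0 h v Q ->
  (forall c, ext inside c0 c -> L c V0) ->
  (forall c v' Q', ext inside c0 c -> seeded c (h - 1) v' Q' -> L c V1) ->
  L c0 (V0 + (V1 - V0) * descent_prob).
Proof.
have /andP[rho0 rho1] := rho01; have /andP[p0 p1] := p01.
move=> V01 [vQ szQ yv sv fresh] fail success.
pose W := V0 + (V1 - V0) * (1 - p ^+ S).
have V0W : V0 <= W by rewrite lerDl mulr_ge0 ?subr_ge0 // exprn_ile1.
have -> : V0 + (V1 - V0) * descent_prob = V0 + (W - V0) * (1 - rho ^+ size [:: v]).
  by rewrite /descent_prob /W /= expr1; ring.
have layer_inside c : ext (fun s => inside s /\ s.2 = h) c0 c -> ext inside c0 c.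
  by apply: extends_sub => s [].
apply: (@likely_cluster c0 h Q V0 W V0W szQ _ _ S c0 [::] [:: v]) => //.
- by move=> c /layer_inside; exact: fail.
- move=> c D c0c uD szD Dy.
  have pair_inj : injective (fun u : X => (u, h - 1)) by move=> a b [].
  have -> : W = V0 + (V1 - V0) *
      (1 - 1 * (1 - (1 - p) * (1 - 0)) ^+ size (map (fun u => (u, h - 1)) D)).
    by rewrite size_map szD mul1r subr0 mulr1 opprB subrKC.
  apply: likely_query_seq => //.
  + exact: measurable_is_open.
  + exact: P_is_open.
  + exact: is_open_independent.
  + by rewrite map_inj_uniq.
  + move=> _ /mapP[u uD' ->]; apply/negP => /c0c.2 /= [uc|[_]]; last exact: int_pred_neq.
    have [yu _] := Dy u uD'.
    by have [/int_pred_neq] := fresh _ uc yu (int_pred_le h).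
  move=> c' cl cc' cl_D cl_closed.
  have cc'_inside : ext inside c c'.
    by apply: extends_sub cc' => _ /mapP[u /Dy[yu _] ->].
  have c0c' := extends_trans (layer_inside _ c0c) cc'_inside.
  case: cl cl_D cl_closed => [|s cl] cl_D cl_closed.
    by rewrite expr0 mulr1 subrr mulr0 addr0; exact: fail.
  rewrite exprS mul0r mulr0 subr0 mulr1 subrKC.
  have /mapP[u uD' es] : s \in map (fun u => (u, h - 1)) D.
    by apply: (mem_subseq cl_D); rewrite mem_head.
  have [yu su] := Dy u uD'.
  apply: (success c' u D) => //; split=> //; first by rewrite szD.
    apply: reached_down (reached_ext cc' su) _ => w c'w.
    by apply: cl_closed c'w _; rewrite es mem_head.
  move=> t /cc'.2 [tc yt th|/mapP[u' u'D ->] _ _] //.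
  have eh : t.2 = h.
    have [tc0|[]//] := c0c.2 _ tc.
    by have [] := fresh t tc0 yt (le_trans th (int_pred_le h)).
  by move: th; rewrite eh int_nle_pred.
- exact: extends_refl.
- by rewrite addn0.
- move=> u; rewrite /= inE => /eqP ->; split=> //.
  by rewrite /seen cats0.
- by move=> s sc [ys sh]; rewrite /seen cats0; apply: (fresh s sc ys _).2; rewrite sh.
Qed.

Lemma likely_descent m c0 h v Q V0 V1 : V0 <= V1 -> seeded c0 h v Q ->
  (forall c, ext inside c0 c -> L c V0) ->
  (forall c z, ext inside c0 c -> fibre y z -> reached c z (h - m%:Z) -> L c V1) ->
  L c0 (V0 + (V1 - V0) * descent_prob ^+ m).
Proof.
move=> V01; elim: m c0 h v Q => [|m IH] c0 h v Q sd fail success.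
  rewrite expr0 mulr1 subrKC; have [_ _ yv sv _] := sd.
  by apply: (success _ v) => //; [exact: extends_refl|rewrite subr0].
pose W := V0 + (V1 - V0) * descent_prob ^+ m.
have V0W : V0 <= W by rewrite lerDl mulr_ge0 ?subr_ge0 // exprn_ge0 // descent_prob_ge0.
have -> : V0 + (V1 - V0) * descent_prob ^+ m.+1 = V0 + (W - V0) * descent_prob.
  by rewrite /W exprSr; ring.
apply: (likely_descent1 V0W sd fail) => c v' Q' c0c sd'.
apply: (IH c (h - 1) v' Q' sd') => [c' cc'|c' z cc' yz sz].
  exact/fail/(extends_trans c0c).
apply: (success _ z) => //; first exact: extends_trans c0c cc'.
by rewrite int_subS.
Qed.

End Attempt.

Hypothesis S_gt0 : (0 < S)%N.

(** The attempt along [i] raises the coordinate [i] by one and leaves the other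
    coordinates in [i0 :: l] fixed, so the subspaces explored by different attempts are
    disjoint; each attempt costs one level before it gains [m]. *)
Lemma likely_attempts (m : nat) (i0 : 'I_d.-1) (l : seq 'I_d.-1) c0 x h V0 V1 : V0 <= V1 ->
  i0 \notin J -> i0 \notin l -> uniq l -> (forall i, i \in l -> i \notin J) ->
  reached c0 x h ->
  (forall s i, s \in keys c0 -> s.1 ord0 i0 = x ord0 i0 -> i \in l ->
     s.1 ord0 i = x ord0 i) ->
  let slab := fun s : X * int => s.1 ord0 i0 = x ord0 i0 in
  (forall c, ext slab c0 c -> L c V0) ->
  (forall c (z : X), ext slab c0 c -> z ord0 i0 = x ord0 i0 ->
     reached c z (h + 1 - m%:Z) -> L c V1) ->
  L c0 (V0 + (V1 - V0) * (1 - (1 - descent_prob ^+ m) ^+ size l)).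
Proof.
move=> V01 i0J; elim: l c0 => [|i l IH] c0 i0l ul lJ sx fresh slab fail success.
  by rewrite expr0 subrr mulr0 addr0; apply/fail/extends_refl.
move: i0l ul; rewrite inE negb_or => /andP[i0i i0l] /= /andP[il ul].
have iJ : i \notin J by apply: lJ; rewrite mem_head.
pose b := descent_prob ^+ m.
have b0 : 0 <= b by rewrite exprn_ge0 // descent_prob_ge0.
have b1 : b <= 1.
  have /andP[rho0 rho1] := rho01; have /andP[p0 p1] := p01.
  apply: exprn_ile1; first exact: descent_prob_ge0.
  by rewrite mulr_ile1 ?subr_ge0 ?gerBl ?exprn_ge0 // exprn_ile1.
pose W := V0 + (V1 - V0) * (1 - (1 - b) ^+ size l).
have WV1 : W <= V1.
  by rewrite /W -{2}(subrKC V0 V1) lerD2l ler_piMr ?subr_ge0 // gerBl exprn_ge0 // subr_ge0.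
have -> : V0 + (V1 - V0) * (1 - (1 - b) ^+ (size l).+1) = W + (V1 - W) * b.
  by rewrite /W exprS; ring.
pose y := x + dir i.
have yx k : k != i -> y ord0 k = x ord0 k by move=> ki; rewrite !mxE eqxx (negbTE ki) addr0.
have yi0 (z : X) : fibre y z -> z ord0 i0 = x ord0 i0 by move=> yz; rewrite (yz _ i0J) yx.
have fibre_slab c c' : ext (fun s => fibre y s.1) c c' -> ext slab c c'.
  by apply: extends_sub => s /yi0.
apply: (@likely_descent y m c0 (h + 1) y [:: y] _ _ WV1).
- split=> //; first by rewrite mem_head.
    apply: reached_side sx.
    by rewrite l1norm_subC /y addrC addKr l1norm_dir.
  move=> s sc ys _; have := fresh s i sc (yi0 _ ys) (mem_head _ _).
  by rewrite (ys _ iJ) !mxE !eqxx => /int_succ_neq.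
- move=> c c0c; apply: IH => //.
  + by move=> j jl; apply: lJ; rewrite inE jl orbT.
  + exact: reached_ext c0c sx.
  + move=> s j /c0c.2 [sc|ys] s0 jl.
      by apply: fresh; rewrite // inE jl orbT.
    rewrite (ys j) ?yx //; first by apply: contraNneq il => <-.
    by apply: lJ; rewrite inE jl orbT.
  + by move=> c' cc'; apply/fail/(extends_trans (fibre_slab _ _ c0c)).
  + move=> c' z cc' z0 sz; apply: (success c' z) => //.
    exact: extends_trans (fibre_slab _ _ c0c) cc'.
- move=> c z c0c yz sz; apply: (success c z) => //; first exact: fibre_slab.
  exact: yi0.
Qed.


Variables (i0 : 'I_d.-1) (l : seq 'I_d.-1).
Hypothesis i0J : i0 \notin J.
Hypothesis i0l : i0 \notin l.
Hypothesis ul : uniq l.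
Hypothesis lJ : forall i, i \in l -> i \notin J.
Hypothesis attempts_succeed : (1 - descent_prob ^+ 3) ^+ size l <= 4^-1.

Lemma likely_reached1 c x : reached c x 1 -> L c 1.
Proof. by move=> sx; apply: likely_sure => w cw; apply: sx cw _; exact: forced_base. Qed.

(** A round multiplies the mean of (3/2) ^ (height - 1) by at most
    (3/4) (2/3) + (1/4) (3/2) = 7/8, and this mean bounds the probability that height 1
    has not been reached. The coordinate [i0] increases in each round, which makes the
    next round independent of the past. *)
Lemma likely_walk r c x (k : nat) : reached c x (k%:Z + 1) ->
  (forall s, s \in keys c -> s.1 ord0 i0 < x ord0 i0) ->
  L c (1 - (3 / 2) ^+ k * (7 / 8) ^+ r).
Proof.
elim: r c x k => [|r IH] c x [|k] sx fresh.
- by apply: likely_le (likely_reached1 sx); rewrite !expr0; lra.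
- apply: likely_le0; rewrite expr0 mulr1 subr_le0 exprn_ege1 //; lra.
- apply: likely_le (likely_reached1 sx); rewrite gerBl mulr_ge0 // exprn_ge0 //; lra.
pose V j : R := 1 - (3 / 2) ^+ j * (7 / 8) ^+ r.
have step c' (z : X) (j : nat) : ext (fun s => s.1 ord0 i0 = x ord0 i0) c c' ->
    z ord0 i0 = x ord0 i0 -> reached c' z j%:Z -> L c' (V j).
  move=> cc' z0 sz; apply: (IH c' (z + dir i0)).
    by apply: reached_side sz; rewrite l1norm_subC addrC addKr l1norm_dir.
  move=> s /cc'.2 sc; rewrite !mxE !eqxx z0 ltzD1.
  by case: sc => [/fresh /ltW|->].
pose a : R := (3 / 2) ^+ k; pose g : R := (7 / 8) ^+ r.
have a0 : 0 <= a by rewrite exprn_ge0 //; lra.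
have g0 : 0 <= g by rewrite exprn_ge0 //; lra.
have ag0 : 0 <= a * g by rewrite mulr_ge0.
pose f := (1 - descent_prob ^+ 3) ^+ size l.
(* Success: one step up, three levels down, one step up to the next hyperplane.
   Failure: only the step to the next hyperplane. *)
apply: (@likely_le _ _ _ _ _ _ _ _ (V k.+2 + (V k - V k.+2) * (1 - f))).
  rewrite /V !exprS -/a -/g.
  have : a * g * f <= a * g * 4^-1 by rewrite ler_wpM2l.
  nra.
apply: (@likely_attempts 3 i0 l c x (k.+1%:Z + 1)) => //.
- rewrite /V lerD2l lerN2 !exprS -/a -/g.
  nra.
- by move=> s i /fresh sx' e; rewrite e ltxx in sx'.
- move=> c' cc'; apply: (step c' x) => //; apply: reached_ext cc' _.
  by rewrite -addn1 PoszD.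
- move=> c' z cc' z0 sz; apply: (step c' z) => //.
  by rewrite (_ : k%:Z = k.+1%:Z + 1 + 1 - 3%:Z) //; exact: int_walk.
Qed.

End Percolation.

(** * Asymptotics of the critical probability *)

Lemma measurable_LIP d : measurable (@LIP d).
Proof.
rewrite LIP_forced -[X in measurable X]setCK setC_bigcap; apply: measurableC.
apply: countable_bigcupT_measurable => [|x]; first exact: countableP.
apply: measurableC; apply: bigcupT_measurable => k; apply: measurableC; exact: measurable_forced.
Qed.

Section Conclusion.
Context {R : realType}.

Lemma bernoulli (x : R) (n : nat) : 0 <= x <= 1 -> (1 - x) ^+ n * (1 + n%:R * x) <= 1.
Proof.
move=> /andP[x0 x1]; elim: n => [|n IH]; first by rewrite expr0 mul0r addr0 mulr1.
apply: le_trans IH; rewrite exprSr -mulrA ler_wpM2l ?exprn_ge0 ?subr_ge0 //.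
have : 0 <= n.+1%:R * x ^+ 2 by rewrite mulr_ge0 // sqr_ge0.
by rewrite -natr1; nra.
Qed.

Lemma expr_le_inv (x b : R) (n : nat) : 0 <= x <= 1 -> 0 < b -> b <= 1 + n%:R * x ->
  (1 - x) ^+ n <= b^-1.
Proof.
move=> /[dup] x01 /andP[x0 x1] b0 bn; rewrite -[leRHS]mul1r ler_pdivlMr //.
apply: le_trans (bernoulli n x01).
by rewrite ler_wpM2l // exprn_ge0 // subr_ge0.
Qed.

(** The events that height [k] is not forced at the origin increase to an event that
    contains LIP. As LIP is measurable, its probability is controlled by theirs. *)
Lemma LIP_le_half d (P : probability (configuration d) R) :
  (forall k : nat, (2^-1 : R)%:E <= P [set w | forced w 0 k%:Z])%E ->
  (P (@LIP d) <= (2^-1 : R)%:E)%E.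
Proof.
move=> half; pose F k := ~` [set w : configuration d | forced w 0 k%:Z].
have mF k : measurable (F k) by apply: measurableC; exact: measurable_forced.
have mU : measurable (\bigcup_k F k) by exact: bigcupT_measurable.
apply: (@le_trans _ _ (P (\bigcup_k F k))).
  apply: le_measure; rewrite ?inE //; first exact: measurable_LIP.
  by rewrite LIP_forced => w; apply.
have ndF : {homo F : n m / (n <= m)%N >-> (n <= m)%O}.
  by move=> m n mn; apply/subsetPset => w /= nf f; apply: nf; apply: forced_le f; rewrite lez_nat.
have cv := nondecreasing_cvg_mu (mu := P) mF mU ndF.
rewrite -(cvg_lim _ cv) //; apply: lime_le; first by apply/cvg_ex; eexists; exact: cv.
apply: nearW => k /=.
rewrite /F probability_setC ?measurable_forced //; last exact: measurable_forced.
have -> : (2^-1 : R)%:E = (1 - (2^-1 : R)%:E)%E by rewrite -EFinB; congr EFin; lra.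
by rewrite leeB.
Qed.

(** The constants are chosen in the order: [kap], the relative loss of directions that
    supercriticality tolerates; [s], with clusters of size d / s; [b0], a lower bound on the
    probability to gain a level; [nu], the number of parallel attempts. Only then is [d]
    taken large. *)
Lemma forced_ge_half (e : R) : 0 < e -> exists d0 : nat, forall d : nat, (d0 <= d)%N ->
  forall P : probability (configuration d) R,
  0 <= 1 - (1 + e) / (2 * d%:R) <= 1 /\
  (site_percolation_law (1 - (1 + e) / (2 * d%:R)) P ->
   forall k : nat, ((2^-1 : R)%:E <= P [set w | forced w 0 k%:Z])%E).
Proof.
move=> e0.
have archi (x : R) : 0 <= x -> exists n : nat, x <= n%:R.
  by move=> x0; exists (Num.bound x); apply/ltW/archi_boundP.
pose kap : R := (e / 2) / (1 + e).
have kap0 : 0 < kap by rewrite /kap !divr_gt0 //; lra.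
have kapE : (1 + e) * kap = e / 2 by rewrite /kap mulrCA divff ?mulr1 //; lra.
(* The clusters use up 5 / (2 s) of the 2 d directions, at most kap / 2. *)
have [s sP] : exists s : nat, 5 / kap <= s%:R by apply: archi; rewrite divr_ge0 // ltW.
have s0 : (0 : R) < s%:R by apply: lt_le_trans sP; rewrite divr_gt0.
(* del = 1 - rho: the survival bound for mean offspring 1 + e / 2. *)
pose del : R := (e / 2) / (1 + e / 2).
have e1 : 0 < 1 + e / 2 by lra.
have del0 : 0 < del by rewrite /del divr_gt0 //; lra.
have delE : 1 - (1 + e / 2)^-1 = del by rewrite /del; field; rewrite lt0r_neq0 //; lra.
have del1 : del <= 1 by rewrite -delE gerBl invr_ge0 ltW.
pose b0 : R := del / (4 * s%:R + 1).
have b0_gt0 : 0 < b0 by rewrite divr_gt0 //; lra.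
(* By the Bernoulli inequality, (1 - b0 ^ 3) ^ nu <= 1 / (1 + nu b0 ^ 3) <= 1 / 4. *)
have [nu nuP] : exists n : nat, 3 / b0 ^+ 3 <= n%:R.
  by apply: archi; rewrite divr_ge0 ?exprn_ge0 // ltW.
have [d1 d1P] : exists n : nat, 2 * (2 + nu%:R) / kap <= n%:R.
  by apply: archi; apply: divr_ge0; [rewrite mulr_ge0 // addr_ge0|exact: ltW].
have [d2 d2P] : exists n : nat, 1 + e <= n%:R by apply: archi; lra.
exists (maxn d1 (maxn d2 (maxn (2 * s) (nu + 2)))) => d.
rewrite !geq_max => /and4P[dd1 dd2 ds dnu] P.
have dR : (0 : R) < d%:R by rewrite ltr0n; clear -dnu; lia.
have d1R : 2 * (2 + nu%:R) / kap <= d%:R :> R by apply: le_trans d1P _; rewrite ler_nat.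
have d2R : 1 + e <= d%:R :> R by apply: le_trans d2P _; rewrite ler_nat.
have dsR : 2 * s%:R <= d%:R :> R by rewrite -natrM ler_nat.
have d2gt0 : (0 : R) < 2 * d%:R by rewrite mulr_gt0.
pose q : R := (1 + e) / (2 * d%:R).
have q0 : 0 < q by rewrite divr_gt0 //; lra.
have q1 : q <= 1 by rewrite ler_pdivrMr //; lra.
have qd : q * (2 * d%:R) = 1 + e by rewrite /q divfK // lt0r_neq0.
rewrite -/q; split; first by rewrite subr_ge0 q1 gerBl ltW.
move=> law k.
have p01 : 0 <= 1 - q <= 1 by rewrite subr_ge0 q1 gerBl ltW.
(* One direction for new hyperplanes, nu for attempts, the rest for clusters. *)
have szI : size (enum 'I_d.-1) = d.-1 by rewrite size_enum_ord.
case enumE : (enum 'I_d.-1) szI (enum_uniq 'I_d.-1) => [|i0 t] szI uI.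
  by move: szI => /=; clear -dnu; lia.
pose l := take nu t; pose J := drop nu t.
have lJt : l ++ J = t by rewrite cat_take_drop.
have szt : size t = d.-2 by exact: (congr1 predn szI).
have szl : size l = nu by rewrite size_takel // szt; clear -dnu; lia.
have szJ : size J = (d - 2 - nu)%N by rewrite size_drop szt; clear -dnu; lia.
move: uI; rewrite -lJt /= mem_cat negb_or cat_uniq => /andP[/andP[i0l i0J] /and3P[ul lJ uJ]].
have {}lJ i : i \in l -> i \notin J.
  by move=> il; apply: contraNN lJ => iJ; apply/hasP; exists i.
pose S := (d %/ s)%N.
have s_gt0 : (0 < s)%N by rewrite -(ltr0n R).
have S_gt0 : (0 < S)%N by rewrite divn_gt0 //; clear -ds; lia.
have Sd : S%:R * s%:R <= d%:R :> R by rewrite -natrM ler_nat leq_trunc_div.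
have dS : d%:R <= 2 * (S%:R * s%:R) :> R.
  rewrite -!natrM ler_nat; have := ltn_ceil d s_gt0; rewrite -/S mulSn.
  by move: (S * s)%N => Ss; clear -ds; lia.
pose rho : R := (1 + e / 2)^-1.
have rho01 : 0 <= rho <= 1 by rewrite invr_ge0 ltW //= invf_le1 //; lra.
have qdel : 0 <= q * del <= 1.
  by apply/andP; split; [apply: mulr_ge0|apply: mulr_ile1] => //; exact: ltW.
have rhoP : (1 - (1 - (1 - q)) * (1 - rho)) ^+ (2 * size J - 5 * S) <= rho.
  rewrite subKr delE; apply: expr_le_inv => //; rewrite lerD2l.
  have : 2 * d%:R - (4 + 2 * nu%:R + 5 * S%:R) <= (2 * size J - 5 * S)%:R :> R.
    by rewrite lerBlDr szJ -!natrM -!natrD ler_nat; generalize S; clear; lia.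
  set m := (_ - _)%:R => mP.
  have H5 : 5 * S%:R <= kap * d%:R.
    apply: (@le_trans _ _ (kap * s%:R * S%:R)).
      by rewrite ler_wpM2r // mulrC -ler_pdivrMr.
    by rewrite -mulrA [s%:R * _]mulrC ler_wpM2l // ltW.
  have Hnu : 2 * (2 + nu%:R) <= kap * d%:R by rewrite [kap * _]mulrC -ler_pdivrMr.
  have mq : 1 + e / 2 <= m * q.
    apply: (@le_trans _ _ ((2 * d%:R - 2 * kap * d%:R) * q)).
      have -> : (2 * d%:R - 2 * kap * d%:R) * q = (1 - kap) * (q * (2 * d%:R)) by ring.
      by rewrite qd mulrBl mul1r [kap * _]mulrC kapE; lra.
    by rewrite ler_wpM2r ?(ltW q0) //; clear -mP Hnu H5; lra.
  rewrite mulrA; apply: (@le_trans _ _ ((1 + e / 2) * del)).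
    by rewrite /del mulrCA divff ?mulr1 // lt0r_neq0.
  by rewrite ler_wpM2r // ltW.
have b0P : b0 <= descent_prob (1 - q) S rho.
  rewrite /b0 /descent_prob delE; apply: ler_wpM2l; first exact: ltW.
  have s41 : (0 : R) < (4 * s%:R + 1) / (4 * s%:R) by rewrite divr_gt0 //; lra.
  have : (1 - q) ^+ S <= ((4 * s%:R + 1) / (4 * s%:R))^-1.
    apply: expr_le_inv => //; first by rewrite ltW.
    rewrite mulrDl divff ?mulf_neq0 ?lt0r_neq0 // lerD2l mul1r.
    rewrite -[_^-1]mul1r ler_pdivrMr ?mulr_gt0 //.
    have : d%:R * q <= 2 * (S%:R * s%:R) * q by rewrite ler_wpM2r // ltW.
    nra.
  rewrite invf_div => h; rewrite lerBrDr -lerBrDl; apply: le_trans h _.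
  rewrite le_eqVlt; apply/orP; left; apply/eqP; field.
  by rewrite lt0r_neq0 //; lra.
have succ : (1 - descent_prob (1 - q) S rho ^+ 3) ^+ size l <= 4^-1.
  have bp1 : descent_prob (1 - q) S rho <= 1.
    have /andP[r0 r1] := rho01; have /andP[p0 p1] := p01.
    by rewrite mulr_ile1 ?subr_ge0 ?gerBl ?exprn_ge0 // exprn_ile1.
  have bp0 : 0 <= descent_prob (1 - q) S rho by apply: le_trans b0P; rewrite ltW.
  apply: (@le_trans _ _ ((1 - b0 ^+ 3) ^+ nu)).
    have b03 : b0 ^+ 3 <= descent_prob (1 - q) S rho ^+ 3.
      by rewrite lerXn2r // nnegrE ltW.
    have d3 : descent_prob (1 - q) S rho ^+ 3 <= 1 by exact: exprn_ile1.
    rewrite szl; apply: lerXn2r; rewrite ?nnegrE ?subr_ge0 //.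
      exact: le_trans b03 d3.
    by rewrite lerD2l lerN2.
  apply: expr_le_inv => //.
    rewrite exprn_ge0 ?(ltW b0_gt0) //= exprn_ile1 ?(ltW b0_gt0) //.
    exact: le_trans b0P bp1.
  move: nuP; rewrite ler_pdivrMr ?exprn_gt0 //; lra.
have [r rP] : exists n : nat, 8 * (2 * (3 / 2) ^+ k) <= n%:R :> R.
  by apply: archi; rewrite !mulr_ge0 // exprn_ge0 // divr_ge0.
have k0 : (0 : R) < 2 * (3 / 2) ^+ k by rewrite mulr_gt0 // exprn_gt0 // divr_gt0.
have r78 : (3 / 2) ^+ k * (7 / 8) ^+ r <= 2^-1 :> R.
  have -> : (7 / 8 : R) = 1 - 8^-1 by lra.
  have : (1 - 8^-1) ^+ r <= (2 * (3 / 2) ^+ k)^-1 :> R.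
    by apply: expr_le_inv => //; lra.
  move=> /(ler_wpM2l (ltW k0)); rewrite divff ?lt0r_neq0 //; lra.
have mE : measurable [set w : configuration d | forced w 0 k%:Z] by exact: measurable_forced.
case: k rP k0 r78 mE => [|k] rP k0 r78 mE.
  rewrite (_ : mkset _ = setT) ?probability_setT ?lee_fin; first lra.
  by apply/seteqP; split=> // w _; apply: forced_base.
have d_gt1 : (1 < d)%N by clear -dnu; lia.
have start : reached [set w : configuration d | forced w 0 k.+1%:Z] [::] 0 (k%:Z + 1).
  by rewrite -(addn1 k) PoszD => w.
have fresh z : z \in map fst ([::] : seq ('rV[int]_d.-1 * int * bool)) ->
  z.1 ord0 i0 < (0 : 'rV[int]_d.-1) ord0 i0 by [].
have := likely_walk d_gt1 law p01 mE uJ rho01 rhoP S_gt0 i0J i0l ul lJ succ r start fresh isT.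
have -> : [set w : configuration d | agrees (@is_open d) [::] w] = setT by apply/seteqP; split.
rewrite setTI probability_setT mulr1 => h.
rewrite -[leRHS]fineK ?fin_num_measure // lee_fin; apply: le_trans h.
have : (3 / 2) ^+ k <= (3 / 2) ^+ k.+1 :> R by apply: ler_weXn2l => //; lra.
have : 0 <= (7 / 8) ^+ r :> R by rewrite exprn_ge0 // divr_ge0.
move=> g0 /(ler_wpM2r g0); lra.
Qed.

End Conclusion.

Theorem mainTheorem5 (R : realType) :
  exists eps : nat -> R,
    (eps d @[d --> \oo] --> (0 : R)) /\
    forall d : nat, (2 <= d)%N ->
    forall P : R -> probability (configuration d) R,
    (forall p : R, 0 <= p <= 1 -> site_percolation_law p (P p)) ->
    forall pL : R, is_critical_probability P pL ->
    1 - (1 + eps d) / (2 * d%:R) <= pL.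
Proof.
pose good (d : nat) (e : R) := forall P : R -> probability (configuration d) R,
  (forall p : R, 0 <= p <= 1 -> site_percolation_law p (P p)) ->
  forall pL : R, is_critical_probability P pL -> 1 - (1 + e) / (2 * d%:R) <= pL.
(* The best correction is the infimum of the valid ones; 2 d is always valid, as
   the bound is then negative. *)
pose G d := [set e : R | 0 <= e /\ good d e].
have G_lb d : has_lbound (G d) by exists 0 => e [].
have good_large (e : R) : 0 < e -> exists d0 : nat, forall d, (d0 <= d)%N -> good d e.
  move=> e0; have [d0 H] := forced_ge_half e0; exists d0 => d dd0 P lawP pL [pL01 crit].
  have [p01 {}H] := H d dd0 (P (1 - (1 + e) / (2 * d%:R))).
  rewrite leNgt; apply/negP => pLp.
  have := LIP_le_half (H (lawP _ p01)); rewrite (crit _ p01).2 // lee_fin; lra.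
have G_ne d : (2 <= d)%N -> (G d !=set0)%classic.
  move=> d2; have dR : (0 : R) < 2 * d%:R by rewrite mulr_gt0 // ltr0n; lia.
  exists (2 * d%:R); split; first exact: ltW.
  move=> P _ pL [/andP[pL0 _] _]; apply: le_trans pL0.
  rewrite subr_le0 mulrDl divff ?lt0r_neq0 // lerDr mul1r invr_ge0; exact: ltW.
exists (fun d => inf (G d)); split.
  apply/cvgrPdist_le => e e0; have [d0 H] := good_large e e0.
  exists (maxn d0 2) => // d /=; rewrite geq_max => /andP[dd0 d2].
  have inf0 : 0 <= inf (G d) by apply: lb_le_inf; [exact: G_ne|move=> x []].
  by rewrite sub0r normrN ger0_norm //; apply: ge_inf => //; split; [exact: ltW|exact: H].
move=> d d2 P lawP pL crit.
have dR : (0 : R) < 2 * d%:R by rewrite mulr_gt0 // ltr0n; lia.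
rewrite lerBlDr -lerBlDl ler_pdivlMr // -lerBlDl.
apply: lb_le_inf; first exact: G_ne.
move=> e [_ /(_ P lawP pL crit)].
by rewrite lerBlDr -lerBlDl ler_pdivlMr // -lerBlDl.
Qed.
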